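(* Let $X$ be any infinite set. Then $\operatorname{rank}(\mathcal P_X:\mathcal E_X)=\operatorname{rank}(\mathcal P_X:\mathcal E_X\cup\mathcal S_X)=2$.
   Context: Partition monoid: let $X'=\{x':x\in X\}$ be a disjoint copy of the set $X$. The elements of $\mathcal P_X$ are all set partitions $\alpha$ of $X\cup X'$ into nonempty blocks. Product: given $\alpha,\beta\in\mathcal P_X$, let $X''=\{x'':x\in X\}$ be a third disjoint copy of $X$; relabel each lower vertex $x'$ of (a graph whose connected components are the blocks of) $\alpha$ as $x''$, relabel each upper vertex $x$ of (a graph representing) $\beta$ as $x''$, and take the union of the two graphs on vertex set $X\cup X''\cup X'$. Then $\alpha\beta\in\mathcal P_X$ is the partition in which $u,v\in X\cup X'$ lie in the same block if and only if they are joined by a (finite) path in this graph. This makes $\mathcal P_X$ a monoid with identity $\{\{x,x'\}:x\in X\}$. $\mathcal S_X$ denotes the group of units of $\mathcal P_X$: the partitions all of whose blocks have the form $\{x,y'\}$ with $x,y\in X$. $\mathcal E_X=\{\alpha\in\mathcal P_X:\alpha=\alpha^2\}$ is the set of idempotents of $\mathcal P_X$. For a subset $T$ of a semigroup $S$, $\langle T\rangle$ is the subsemigroup generated by $T$, and the relative rank $\operatorname{rank}(S:T)$ is the minimum cardinality of a subset $U\subseteq S$ with $S=\langle T\cup U\rangle$. *)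

(* Defs.v *)
From Stdlib Require Import Relation_Operators.
From HB Require Import structures.
From mathcomp Require Import all_boot all_classical.

Set Implicit Arguments.
Unset Strict Implicit.
Unset Printing Implicit Defensive.

Local Open Scope classical_set_scope.
Local Open Scope card_scope.
Local Open Scope group_scope.

(* The disjoint union of X and its copy X' is X + X: inl x stands for x and
   inr x for x'. *)
Record pmonoid (X : Type) : Type := PMonoid {
  blocks : set (set (X + X));
  blocksP : partition blocks id [set: X + X]
}.

Section PartitionMonoid.
Context {X : Type}.
Implicit Types (a b c : pmonoid X) (B : set (X + X)) (A C D : set X).

HB.instance Definition _ := gen_eqMixin (pmonoid X).
HB.instance Definition _ := gen_choiceMixin (pmonoid X).

Definition same_block a (u v : X + X) : Prop :=
  exists2 B, blocks a B & B u /\ B v.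

(* Vertices x, x'' and x' of the graph defining a product. *)
Inductive vertex : Type := Upper of X | Middle of X | Lower of X.

Definition left_vertex (u : X + X) : vertex :=
  match u with inl x => Upper x | inr x => Middle x end.

Definition right_vertex (u : X + X) : vertex :=
  match u with inl x => Middle x | inr x => Lower x end.

Definition outer_vertex (u : X + X) : vertex :=
  match u with inl x => Upper x | inr x => Lower x end.

(* Each partition is represented by the graph in which any two elements of a
   common block are adjacent. *)
Inductive product_edge a b : vertex -> vertex -> Prop :=
| LeftEdge u v : same_block a u v ->
    product_edge a b (left_vertex u) (left_vertex v)
| RightEdge u v : same_block b u v ->
    product_edge a b (right_vertex u) (right_vertex v).

Definition joined a b : vertex -> vertex -> Prop :=
  clos_refl_trans vertex (product_edge a b).

Definition product_blocks a b : set (set (X + X)) :=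
  [set [set v | joined a b (outer_vertex u) (outer_vertex v)]
    | u in [set: X + X]].

Lemma same_block_refl a u : same_block a u u.
Proof.
have [cov _ _] := blocksP a.
have : (\bigcup_(B in blocks a) id B) u by rewrite -coverE cov.
by case=> B aB Bu; exists B.
Qed.

Lemma same_block_sym a u v : same_block a u v -> same_block a v u.
Proof. by case=> B aB [Bu Bv]; exists B. Qed.

Lemma same_blockP a u B : blocks a B -> B u -> B = [set v | same_block a u v].
Proof.
move=> aB Bu; apply/seteqP; split=> v /=; first by move=> Bv; exists B.
case=> C aC [Cu Cv]; have [_ tri _] := blocksP a.
by rewrite (tri B C aB aC) //; exists u.
Qed.

Lemma same_block_class a u : blocks a [set v | same_block a u v].
Proof.
case: (same_block_refl a u) => B aB [Bu _].
by rewrite -(same_blockP aB Bu).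
Qed.

Lemma joined_sym a b p q : joined a b p q -> joined a b q p.
Proof.
elim=> [r s rs|r|r s t _ sr _ ts].
- apply: rt_step; case: rs => u v /same_block_sym uv.
    exact: LeftEdge.
  exact: RightEdge.
- exact: rt_refl.
- exact: rt_trans ts sr.
Qed.

Lemma product_blocksP a b : partition (product_blocks a b) id [set: X + X].
Proof.
split.
- apply/seteqP; split=> // u _.
  exists [set v | joined a b (outer_vertex u) (outer_vertex v)].
    by exists u.
  exact: rt_refl.
- move=> _ _ [u _ <-] [v _ <-] [w [/= uw vw]].
  have uv : joined a b (outer_vertex u) (outer_vertex v).
    exact: rt_trans uw (joined_sym vw).
  apply/seteqP; split=> t /= h; last exact: rt_trans uv h.
  exact: rt_trans (joined_sym uv) h.
- by move=> _ [u _ <-]; exists u; exact: rt_refl.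
Qed.

Definition pmul a b : pmonoid X := PMonoid (product_blocksP a b).

Definition identity_blocks : set (set (X + X)) :=
  [set [set inl x; inr x] | x in [set: X]].

Lemma identity_blocksP : partition identity_blocks id [set: X + X].
Proof.
split.
- by apply/seteqP; split=> // -[x|x] _; exists [set inl x; inr x];
    (try by exists x); [left|right].
- by move=> _ _ [x _ <-] [y _ <-] [_ [[->|->]]] [] // [->].
- by move=> _ [x _ <-]; exists (inl x); left.
Qed.

Definition pone : pmonoid X := PMonoid identity_blocksP.

(* A pair of subsets of X is compatible with a when the corresponding subset
   of X + X is a union of blocks; products become relational compositions. *)
Definition glue A C : set (X + X) :=
  fun u => match u with inl x => A x | inr x => C x end.

Definition compat a A C : Prop :=
  forall u v, same_block a u v -> glue A C u -> glue A C v.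

Lemma pmonoid_eq a b : blocks a = blocks b -> a = b.
Proof.
case: a b => [s sP] [t tP] /= st; subst t.
by rewrite (Prop_irrelevance sP tP).
Qed.

Lemma same_block_inj a b : same_block a = same_block b -> a = b.
Proof.
suff sub c d : same_block c = same_block d -> blocks c `<=` blocks d.
  by move=> ab; apply: pmonoid_eq; apply/seteqP; split; apply: sub.
move=> cd B cB; have [_ _ ne] := blocksP c; have [u Bu] := ne B cB.
rewrite (same_blockP cB Bu) cd; exact: same_block_class.
Qed.

Lemma glueE B : glue [set x | B (inl x)] [set x | B (inr x)] = B.
Proof. by apply/funext => -[]. Qed.

Lemma compat_class a u :
  compat a [set x | same_block a u (inl x)] [set x | same_block a u (inr x)].
Proof.
move=> v w vw; rewrite (glueE (same_block a u)) => -[B aB [Bu Bv]].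
by exists B => //; split=> //; rewrite (same_blockP aB Bv).
Qed.

Lemma compat_inj a b : (forall A C, compat a A C <-> compat b A C) -> a = b.
Proof.
move=> ab; apply: same_block_inj.
suff sub c d : (forall A C, compat c A C <-> compat d A C) ->
    forall u v, same_block d u v -> same_block c u v.
  apply/funext => u; apply/funext => v; apply/propext; split.
    by apply: sub => A C; split=> /ab.
  exact: sub.
move=> cd u v uv; have /cd := @compat_class c u.
move=> /(_ u v uv); rewrite (glueE (same_block c u)).
apply; exact: same_block_refl.
Qed.

Lemma compatM a b A D :
  compat (pmul a b) A D <-> exists2 C, compat a A C & compat b C D.
Proof.
have blk u v : same_block (pmul a b) u v <->
    joined a b (outer_vertex u) (outer_vertex v).
  split=> [[_ [w _ <-] [/= wu wv]]|uv].
    exact: rt_trans (joined_sym wu) wv.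
  exists [set v | joined a b (outer_vertex u) (outer_vertex v)].
    by exists u.
  by split=> //; exact: rt_refl.
split=> [abAD|[C aAC bCD] u v /blk].
  pose col p := exists2 u, glue A D u & joined a b (outer_vertex u) p.
  have colO u : col (outer_vertex u) <-> glue A D u.
    split=> [[v Av vu]|]; last by exists u => //; exact: rt_refl.
    by apply: abAD Av; apply/blk.
  have colE p q : product_edge a b p q -> col p -> col q.
    by move=> pq [u Au up]; exists u => //; apply: rt_trans up (rt_step _ _ _ _ pq).
  have colL u : glue A [set x | col (Middle x)] u <-> col (left_vertex u).
    by case: u => x //=; split=> /(colO (inl x)).
  have colR u : glue [set x | col (Middle x)] D u <-> col (right_vertex u).
    by case: u => x //=; split=> /(colO (inr x)).
  exists [set x | col (Middle x)] => u v uv.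
    by move=> /colL/(colE _ _ (LeftEdge b uv))/colL.
  by move=> /colR/(colE _ _ (RightEdge a uv))/colR.
pose col p := match p with Upper x => A x | Middle x => C x | Lower x => D x end.
suff : forall p q, joined a b p q -> col p -> col q.
  move=> h /h; have colO w : col (outer_vertex w) = glue A D w by case: w.
  by rewrite !colO.
have colL w : col (left_vertex w) = glue A C w by case: w.
have colR w : col (right_vertex w) = glue C D w by case: w.
move=> p q; elim=> [r s|//|r s t _ rs _ st /rs/st //].
case=> w z wz; rewrite ?colL ?colR; [exact: aAC|exact: bCD].
Qed.

Lemma compat1 A C : compat pone A C <-> A = C.
Proof.
split=> [oAC|<- u v [_ [x _ <-] [[->|->] [->|->]]] //].
have oo x u v : [set inl x; inr x] u -> [set inl x; inr x] v ->
    same_block pone u v.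
  by move=> ? ?; exists [set inl x; inr x] => //; exists x.
apply/seteqP; split=> x Ax.
  by apply: (oAC (inl x) (inr x)) => //; apply: (oo x); [left|right].
by apply: (oAC (inr x) (inl x)) => //; apply: (oo x); [right|left].
Qed.

Lemma pmulA : associative pmul.
Proof.
move=> a b c; apply: compat_inj => A D; rewrite !compatM; split.
- move=> [C aAC /compatM[C' bCC' cC'D]].
  by exists C' => //; apply/compatM; exists C.
- move=> [C /compatM[C' aAC' bC'C] cCD].
  by exists C' => //; apply/compatM; exists C.
Qed.

Lemma pmul1 : left_id pone pmul.
Proof.
move=> a; apply: compat_inj => A D; rewrite compatM; split.
  by move=> [C /compat1 ->].
by exists A => //; apply/compat1.
Qed.

Lemma pmulr1 : right_id pone pmul.
Proof.
move=> a; apply: compat_inj => A D; rewrite compatM; split.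
  by move=> [C ? /compat1 <-].
by exists D => //; apply/compat1.
Qed.

HB.instance Definition _ := isMonoid.Build (pmonoid X) pmulA pmul1 pmulr1.

Definition pmonoid_units : set (pmonoid X) :=
  [set a | forall B, blocks a B -> exists x y : X, B = [set inl x; inr y]].

Definition flip (u : X + X) : X + X :=
  match u with inl x => inr x | inr x => inl x end.

Lemma flipK : involutive flip. Proof. by case. Qed.

Lemma flip_blocksP a :
  partition [set B | blocks a (flip @^-1` B)] id [set: X + X].
Proof.
have [cov tri ne] := blocksP a.
have flipKs B : flip @^-1` (flip @^-1` B) = B.
  by apply/funext => u; rewrite /preimage/= flipK.
split.
- apply/seteqP; split=> // u _.
  case: (same_block_refl a (flip u)) => B aB [Bu _].
  by exists (flip @^-1` B) => //=; rewrite flipKs.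
- move=> B C aB aC [u [Bu Cu]]; rewrite -(flipKs B) -(flipKs C).
  congr (_ @^-1` _); apply: (tri _ _ aB aC).
  by exists (flip u); split; rewrite /= /preimage/= flipK.
- by move=> B /ne[u Bu]; exists (flip u).
Qed.

Definition pflip a : pmonoid X := PMonoid (flip_blocksP a).

Lemma compat_flip a A C : compat (pflip a) A C <-> compat a C A.
Proof.
have glF (A' C' : set X) u : glue A' C' (flip u) = glue C' A' u by case: u.
have sbF u v : same_block (pflip a) u v <-> same_block a (flip u) (flip v).
  split=> -[B aB [Bu Bv]].
    by exists (flip @^-1` B) => //; rewrite /preimage/= !flipK.
  exists (flip @^-1` B) => //=.
  by congr (blocks a _): aB; apply/funext => w; rewrite /preimage/= flipK.
split=> cp u v uv.
  have /cp : same_block (pflip a) (flip u) (flip v) by apply/sbF; rewrite !flipK.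
  by rewrite !glF.
by move/sbF: uv => /cp; rewrite !glF.
Qed.

Lemma compat_units a A C : pmonoid_units a ->
  compat a A C <-> (forall x y, same_block a (inl x) (inr y) -> A x <-> C y).
Proof.
move=> ua; split=> [cp x y xy|AC u v [B aB]].
  by split; [apply: cp xy|apply: cp (same_block_sym xy)].
have [x [y BE]] := ua B aB.
have xy : same_block a (inl x) (inr y).
  by exists B => //; rewrite BE; split; [left|right].
by rewrite BE => -[[->|->] [->|->]] //= /(AC x y xy).
Qed.

Lemma pmonoid_unitsP a :
  pmonoid_units a <-> exists b, a * b = 1 /\ b * a = 1.
Proof.
split=> [ua|[b [ab ba]]].
  have tot u : exists x y, same_block a u (inl x) /\ same_block a u (inr y).
    have [B aB [Bu _]] := same_block_refl a u; have [x [y BE]] := ua B aB.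
    exists x, y; split; exists B => //; split=> //; rewrite BE; by [left|right].
  have l_inj x x' y : same_block a (inl x) (inr y) ->
      same_block a (inl x') (inr y) -> x = x'.
    move=> [B aB [Bx By]] /same_block_sym[C aC [Cy Cx']].
    have [_ tri _] := blocksP a.
    have BC : B = C by apply: (tri _ _ aB aC); exists (inr y).
    subst C; have [x0 [y0 BE]] := ua B aB.
    by move: Bx Cx'; rewrite BE => -[[->]|//] [[->]|//].
  have r_inj x y y' : same_block a (inl x) (inr y) ->
      same_block a (inl x) (inr y') -> y = y'.
    move=> [B aB [Bx By]] [C aC [Cx Cy']].
    have [_ tri _] := blocksP a.
    have BC : B = C by apply: (tri _ _ aB aC); exists (inl x).
    subst C; have [x0 [y0 BE]] := ua B aB.
    by move: By Cy'; rewrite BE => -[//|[->]] [//|[->]].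
  exists (pflip a); split; apply: compat_inj => A D;
    rewrite compatM compat1; split.
  - move=> [C /(compat_units _ _ ua) AC /compat_flip/(compat_units _ _ ua) DC].
    apply/seteqP; split=> x; have [_ [y [_ xy]]] := tot (inl x).
      by move/(AC x y xy)/(DC x y xy).
    by move/(DC x y xy)/(AC x y xy).
  - move=> <-; have cp : compat a A
        [set y | exists2 x, same_block a (inl x) (inr y) & A x].
      apply/(compat_units _ _ ua) => x y xy; split; first by exists x.
      by move=> [x' x'y]; rewrite (l_inj _ _ _ xy x'y).
    eexists; first exact: cp; exact/compat_flip.
  - move=> [C /compat_flip/(compat_units _ _ ua) CA /(compat_units _ _ ua) CD].
    apply/seteqP; split=> y; have [x [_ [/same_block_sym xy _]]] := tot (inr y).
      by move/(CA x y xy)/(CD x y xy).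
    by move/(CD x y xy)/(CA x y xy).
  - move=> <-; have cp : compat a
        [set x | exists2 y, same_block a (inl x) (inr y) & A y] A.
      apply/(compat_units _ _ ua) => x y xy; split; last by exists y.
      by move=> [y' xy']; rewrite (r_inj _ _ _ xy xy').
    eexists; last exact: cp; exact/compat_flip.
have cab A D : A = D <-> exists2 C, compat a A C & compat b C D.
  by rewrite -compat1 -compatM -[pmul a b]/(a * b) ab.
have cba A D : A = D <-> exists2 C, compat b A C & compat a C D.
  by rewrite -compat1 -compatM -[pmul b a]/(b * a) ba.
have left_ex A : exists C, compat a A C.
  by have /cab[C] := erefl A; exists C.
have right_ex C : exists A, compat a A C.
  by have /cba[A] := erefl C; exists A.
have bE A C : compat a A C -> compat b C A.
  move=> aAC; have /cba[A' bCA' aA'C] := erefl C.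
  suff -> : A = A' by [].
  by apply/cab; exists C.
have funR A C C' : compat a A C -> compat a A C' -> C = C'.
  by move=> /bE bCA aAC'; apply/cba; exists A.
have injR A A' C : compat a A C -> compat a A' C -> A = A'.
  by move=> aAC /bE bCA'; apply/cab; exists C.
move=> B aB; have [_ _ ne] := blocksP a; have [u Bu] := ne B aB.
have a00 : compat a set0 set0 by move=> [v|v] [w|w].
have cB : compat a [set x | B (inl x)] [set x | B (inr x)].
  move=> v w vw; rewrite (glueE B) => Bv.
  rewrite (same_blockP aB Bv); exact: vw.
have [x Bx] : exists x, B (inl x).
  apply: contrapT => nB; case: u Bu => y By; first by apply: nB; exists y.
  have E : [set x | B (inl x)] = set0.
    by apply/seteqP; split=> // x Bx; apply: nB; exists x.
  rewrite E in cB.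
  by have /seteqP[/(_ y By)] := funR _ _ _ cB a00.
have [y By] : exists y, B (inr y).
  apply: contrapT => nB.
  have E : [set x | B (inr x)] = set0.
    by apply/seteqP; split=> // y By; apply: nB; exists y.
  rewrite E in cB.
  by have /seteqP[/(_ x Bx)] := injR _ _ _ cB a00.
exists x, y; apply/seteqP; split=> [[z|z] Bz|_ [->|->] //].
  left; have [C cp] := left_ex [set x].
  have /(cp (inl x) (inl z)) : same_block a (inl x) (inl z) by exists B.
  by move=> /(_ erefl) /= ->.
right; have [A cp] := right_ex [set y].
have /(cp (inr y) (inr z)) : same_block a (inr y) (inr z) by exists B.
by move=> /(_ erefl) /= ->.
Qed.

End PartitionMonoid.

Arguments pmonoid_units : clear implicits.

Definition idempotents (S : semigroupType) : set S := [set a | a = a * a].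

Arguments idempotents : clear implicits.

Definition mul_closed (S : semigroupType) (T : set S) : Prop :=
  forall a b, T a -> T b -> T (a * b).

Definition subsemigroup (S : semigroupType) (T : set S) : set S :=
  smallest (@mul_closed S) T.

(* rank(S : T) is the cardinality of K. *)
Definition relative_rank_is (S : semigroupType) (T : set S)
    (I : Type) (K : set I) : Prop :=
  (exists2 U : set S, subsemigroup (T `|` U) = [set: S] & U #= K) /\
  (forall U : set S, subsemigroup (T `|` U) = [set: S] -> K #<= U).

(* Main.v *)
(* Upper bound. As X is infinite, X + X embeds in X, i.e. there are injections
   f, g : X -> X with disjoint images. Let alpha have the blocks {x, (f x)'} and
   beta the blocks {g x, x'}, all other blocks being singletons. If e is an
   idempotent whose blocks all have the form D + D', then alpha * e * beta
   restricts the induced equivalence on X to f(X) and g(X), seen as the upper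
   and the lower row; every partition arises in this way.

   Lower bound. The elements x that are units as soon as they are right
   invertible form a subsemigroup containing the units and the idempotents, and
   likewise on the left. A single further generator lies in one of these two
   subsemigroups, but both are proper. *)
Require Import Defs.
From mathcomp Require Import all_boot all_classical.
Local Open Scope classical_set_scope.

(** * Doubling an infinite set *)

Lemma infinite_set_seq {X : Type} {A : set X} :
  infinite_set A -> exists s : nat -> X, injective s /\ forall n, A (s n).
Proof.
move=> /infiniteP/card_leP[s]; exists (fun n => val (s (SigSub (in_setT n)))).
split=> [m n /val_inj/(@inj _ _ _ s)|n]; last exact: set_valP.
by move=> /(_ (mem_set I) (mem_set I)) [].
Qed.

(* Zorn's lemma on relations G that restrict to injective relations from
   D * bool to D for D the domain of G; a maximal G has cofinite domain, and a
   finite remainder is absorbed by a sequence in D. *)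
Lemma infinite_bool_prod_inj {X : Type} :
  infinite_set [set: X] -> exists h : X * bool -> X, injective h.
Proof.
move=> infX.
(* [G] may be multivalued: [(x, b, y)] offers [y] as a value at [(x, b)], and choice picks one
   later. Distinct arguments share no value, and values stay in the domain. *)
pose P (G : set (X * bool * X)) :=
  (forall p q y, G (p, y) -> G (q, y) -> p = q) /\
  (forall x b y c, G (x, b, y) ->
    (exists z, G (x, c, z)) /\ (exists z, G (y, c, z))).
have [F FP tot|G [[Ginj Gcl] Gmax]] := @Zorn_bigcup _ P.
  split=> [p q y [A FA Apy] [B FB Bqy]|x b y c [A FA Axy]].
    have [AB|BA] := tot A B FA FB.
      exact: (FP B FB).1 (AB _ Apy) Bqy.
    exact: (FP A FA).1 Apy (BA _ Bqy).
  have [[z Az] [w Aw]] := (FP A FA).2 _ _ _ c Axy.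
  by split; [exists z|exists w]; exists A.
pose D : set X := [set x | exists b y, G (x, b, y)].
have DG x c : D x -> exists2 z, G (x, c, z) & D z.
  move=> [b [y Gxy]]; have [[z xz] _] := Gcl _ _ _ c Gxy.
  exists z => //.
  by have [_ [w zw]] := Gcl _ _ _ c xz; exists c, w.
have finD : finite_set (~` D).
  apply: contrapT => /infinite_set_seq[s [s_inj sD]].
  (* The bijection (n, b) -> 2n + b from [nat * bool] to [nat], copied along [s], lives outside [D]
     and so extends [G]. *)
  pose N : set (X * bool * X) :=
    [set (s nb.1, nb.2, s (nb.1.*2 + nb.2)%N) | nb in [set: nat * bool]].
  have Ncl n c : exists z, N (s n, c, z) by eexists; exists (n, c).
  apply: (Gmax (G `|` N)).
    split=> [p Gp|/(_ (s 0, true, s 1))]; first by left.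
    have N0 : N (s 0, true, s 1) by exists (0, true).
    by move=> /(_ (or_intror N0)) G0; apply: (sD 0); exists true, (s 1).
  split.
    have NG p q y : N (p, y) -> ~ G (q, y).
      move=> [[n b] _ [_ <-]] /=; case: q => x c Gq.
      have [_ [z Gz]] := Gcl _ _ _ c Gq.
      by apply: (sD (n.*2 + b)%N); exists c, z.
    move=> p q y [Gp|Np] [Gq|Nq]; [exact: Ginj Gp Gq|by case: (NG q p y)|
      by case: (NG p q y)|].
    case: Np Nq => -[n b] _ [<- <-] [[m c] _ [<- /s_inj]] /= e.
    have bc : b = c by move/(congr1 odd): e; rewrite !oddD !odd_double !oddb.
    by subst c; move/addIn/double_inj: e => ->.
  move=> x b y c [Gx|[[n b'] _ [<- _ <-]]].
    have [[z Gz] [w Gw]] := Gcl _ _ _ c Gx.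
    by split; [exists z|exists w]; left.
  have [[z Nz] [w Nw]] := (Ncl n c, Ncl (n.*2 + b')%N c).
  by split; [exists z|exists w]; right.
have [s [s_inj sD]] : exists s : nat -> X, injective s /\ forall n, D (s n).
  apply: infinite_set_seq; apply: sub_infinite_set (infinite_setD infX finD).
  by move=> x [_ /contrapT].
have [r r_inj] : exists r : X -> nat,
    forall x y, ~ D x -> ~ D y -> r x = r y -> x = y.
  have /pcard_leP[r] := finite_set_countable finD.
  by exists r => x y nx ny; apply: inj; apply: mem_set.
have /choice[h hG] (p : X * bool) : exists z, D p.1 -> G (p, z) /\ D z.
  case: p => x b; have [/(DG x b)[z]|nDx] := EM (D x); first by exists z.
  by exists x.
have h_inj p q : D p.1 -> D q.1 -> h p = h q -> p = q.
  by move=> /hG[Gp _] /hG[Gq _] pq; apply: Ginj Gp _; rewrite pq.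
(* [j] embeds X in [D]; the boolean keeps the images of [D] and of its complement apart. *)
pose j x := if `[< D x >] then h (x, true) else h (s (r x), false).
have jD x : D (j x).
  rewrite /j; case: asboolP => [Dx|_]; first by have [] := hG (x, true) Dx.
  by have [] := hG (s (r x), false) (sD _).
have j_inj x y : j x = j y -> x = y.
  rewrite /j; case: asboolP => [Dx|nDx]; case: asboolP => [Dy|nDy] /h_inj E.
  - by case: (E Dx Dy).
  - by case: (E Dx (sD _)).
  - by case: (E (sD _) Dy).
  - by case: (E (sD _) (sD _)) => /s_inj/r_inj; apply.
exists (fun p => h (j p.1, p.2)) => -[x b] [y c] /h_inj /=.
by move=> /(_ (jD _) (jD _)) [/j_inj -> ->].
Qed.

Local Open Scope card_scope.
Local Open Scope group_scope.

(** * The lower bound in an arbitrary monoid *)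

Lemma card_ge2 (T : Type) (A : set T) :
  (exists x y, [/\ A x, A y & x <> y]) -> `I_2 #<= A.
Proof.
move=> [x [y [Ax Ay xy]]].
pose f (n : nat) := if n == 0%N then x else y.
have f_inj : {in `I_2 &, injective f}.
  move=> m n; rewrite !in_setE /f.
  case: m => [|[|//]]; case: n => [|[|//]] //= _ _ E; by case: xy.
rewrite -(card_le_eql (inj_card_eq f_inj)); apply: subset_card_le.
by move=> _ [n _ <-]; rewrite /f; case: eqP.
Qed.

Section OneSidedUnits.
Context {M : monoidType}.
Implicit Types (x y : M) (U : set M).

Definition right_invertible x := exists y, x * y = 1.
Definition left_invertible x := exists y, y * x = 1.
Definition invertible x := exists y, x * y = 1 /\ y * x = 1.

Lemma two_sided_invertible {x} :
  right_invertible x -> left_invertible x -> invertible x.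
Proof.
move=> [y xy] [z zx]; exists y; split=> //.
by rewrite -[y]mul1g -zx -(mulgA z) xy mulg1 zx.
Qed.

(** If x y has right inverse z, then x is right invertible, hence a unit, and conjugating by x makes
    z x a right inverse of y. *)
Lemma right_invertible_closed :
  mul_closed [set x : M | right_invertible x -> invertible x].
Proof.
move=> x y /= ix iy [z xyz].
have [|x' [xx' x'x]] := ix; first by exists (y * z); rewrite mulgA.
have [|y' [yy' y'y]] := iy.
  exists (z * x); have -> : y * (z * x) = x' * (x * y * z) * x.
    by rewrite !mulgA x'x mul1g.
  by rewrite xyz mulg1.
exists (y' * x'); split.
  by rewrite mulgA -(mulgA x) yy' mulg1.
by rewrite mulgA -(mulgA y') x'x mulg1.
Qed.

(** Mirror image: here y is a unit first, and y z becomes a left inverse of x. *)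
Lemma left_invertible_closed :
  mul_closed [set x : M | left_invertible x -> invertible x].
Proof.
move=> x y /= ix iy [z zxy].
have [|y' [yy' y'y]] := iy; first by exists (z * x); rewrite -mulgA.
have [|x' [xx' x'x]] := ix.
  exists (y * z); have -> : y * z * x = y * (z * (x * y)) * y'.
    by rewrite -!mulgA yy' mulg1.
  by rewrite zxy mulg1.
exists (y' * x'); split.
  by rewrite mulgA -(mulgA x) yy' mulg1.
by rewrite mulgA -(mulgA y') x'x mulg1.
Qed.

Lemma idempotent_right_invertible {x} :
  idempotents M x -> right_invertible x -> x = 1.
Proof. by move=> e [y xy]; rewrite -[x]mulg1 -xy mulgA -e. Qed.

Lemma idempotent_left_invertible {x} :
  idempotents M x -> left_invertible x -> x = 1.
Proof. by move=> e [y yx]; rewrite -[x]mul1g -yx -mulgA -e. Qed.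

Lemma invertible1 : invertible 1.
Proof. by exists 1; rewrite mulg1. Qed.

Lemma relative_rank_ge2 (a b : M) U : a * b = 1 -> b * a <> 1 ->
  subsemigroup ((idempotents M `|` invertible) `|` U) = [set: M] ->
  `I_2 #<= U.
Proof.
move=> ab ba gen; apply: card_ge2; apply: contrapT => U1.
have Ueq x y : U x -> U y -> x = y.
  by move=> Ux Uy; apply: contrapT => xy; apply: U1; exists x, y.
have only T : mul_closed T -> idempotents M `|` invertible `<=` T ->
    U `<=` T -> forall x, T x.
  move=> Tm T0 TU x; suff : subsemigroup (idempotents M `|` invertible `|` U) `<=` T.
    by rewrite gen; apply.
  by apply: smallest_sub => // y [/T0|/TU].
have ba_unit c d : c * d = 1 -> invertible c \/ invertible d -> d * c = 1.
  move=> cd [[e [ce ec]]|[e [de ed]]].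
    suff -> : d = e by [].
    by rewrite -[d]mul1g -ec -mulgA cd mulg1.
  suff -> : c = e by [].
  by rewrite -[c]mulg1 -de mulgA cd mul1g.
(* In the first case [a] would be a unit. Otherwise [U] consists of a right invertible [g], which a
   left inverse would make a unit, so [b] would be a unit. *)
have [UR|/existsNP[g /not_implyP[Ug /not_implyP[gR gN]]]] :=
  EM (forall g, U g -> right_invertible g -> invertible g).
  apply: ba; apply: ba_unit => //; left.
  apply: (only _ right_invertible_closed) => //.
    move=> x [xx /(idempotent_right_invertible xx) ->|ux _ //].
    exact: invertible1.
  by exists b.
apply: ba; apply: ba_unit => //; right.
apply: (only _ left_invertible_closed) => //.
- move=> x [xx /(idempotent_left_invertible xx) ->|ux _ //].
  exact: invertible1.
- by move=> x /(Ueq _ _ Ug) <- /(two_sided_invertible gR).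
by exists a.
Qed.

End OneSidedUnits.

(** * Partitions as kernels of maps, and the factorization *)

Section KernelPartitions.
Context {X : Type}.

Lemma same_block_trans (a : pmonoid X) u v w :
  same_block a u v -> same_block a v w -> same_block a u w.
Proof.
move=> [B aB [Bu Bv]] vw; exists B => //; split=> //.
by rewrite (same_blockP aB Bv).
Qed.

Definition kernel_blocks {T : Type} (k : X + X -> T) : set (set (X + X)) :=
  [set [set v | k u = k v] | u in [set: X + X]].

Lemma kernel_blocksP {T : Type} (k : X + X -> T) :
  partition (kernel_blocks k) id [set: X + X].
Proof.
split.
- by apply/seteqP; split=> // u _; exists [set v | k u = k v] => //; exists u.
- by move=> _ _ [u _ <-] [v _ <-] [w [/= -> ->]].
- by move=> _ [u _ <-]; exists u.
Qed.

Definition kernel {T : Type} (k : X + X -> T) : pmonoid X :=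
  PMonoid (kernel_blocksP k).

Lemma same_block_kernel {T : Type} (k : X + X -> T) u v :
  same_block (kernel k) u v <-> k u = k v.
Proof.
split=> [[_ [w _ <-] [/= -> ->]] //|uv].
by exists [set w | k u = k w] => //; exists u.
Qed.

(** For injective [f] the blocks are {x, (f x)'} and singletons. On compatible pairs it acts as the
    preimage map of [f]. *)
Definition graph_partition (f : X -> X) : pmonoid X :=
  kernel (fun u => match u with inl x => f x | inr y => y end).

Lemma compat_graph f A C : compat (graph_partition f) A C <-> A = f @^-1` C.
Proof.
split=> [fAC|-> u v /same_block_kernel].
  apply/seteqP; split=> x Ax.
    by apply: (fAC (inl x) (inr (f x))) => //; apply/same_block_kernel.
  by apply: (fAC (inr (f x)) (inl x)) => //; apply/same_block_kernel.
by case: u => x; case: v => y /=; rewrite /preimage/= => ->.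
Qed.

Lemma graph_right_inverse f : injective f ->
  graph_partition f * pflip (graph_partition f) = 1.
Proof.
move=> f_inj; apply: compat_inj => A D; rewrite compatM compat1; split.
  by move=> [C /compat_graph -> /compat_flip/compat_graph ->].
move=> <-; have E : A = f @^-1` (f @` A).
  by apply/seteqP; split=> x; [exists x|move=> [y Ay /f_inj <-]].
by exists (f @` A); [|apply/compat_flip]; apply/compat_graph.
Qed.

(** {y} and the empty set have the same preimage, so the product relates them, unlike the
    identity. *)
Lemma graph_not_left_inverse f y : (forall x, f x <> y) ->
  pflip (graph_partition f) * graph_partition f <> 1.
Proof.
move=> fy ff; have : compat (1 : pmonoid X) [set y] set0.
  rewrite -ff; apply/compatM; exists set0; last exact/compat_graph.
  by apply/compat_flip/compat_graph/seteqP; split=> // x /fy.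
by move/compat1/seteqP => [/(_ y erefl)].
Qed.

(** The blocks are D + D' for the nonempty fibres D of [k]. It acts as the identity on saturated
    sets, whence its idempotence. *)
Definition double_partition {T : Type} (k : X -> T) : pmonoid X :=
  kernel (fun u => match u with inl x | inr x => k x end).

Definition saturated {T : Type} (k : X -> T) (A : set X) :=
  forall x y, k x = k y -> A x -> A y.

Lemma compat_double {T : Type} (k : X -> T) A C :
  compat (double_partition k) A C <-> A = C /\ saturated k A.
Proof.
split=> [kAC|[<- sA] u v /same_block_kernel].
  have AC : A = C.
    apply/seteqP; split=> x Ax.
      by apply: (kAC (inl x) (inr x)) => //; apply/same_block_kernel.
    by apply: (kAC (inr x) (inl x)) => //; apply/same_block_kernel.
  split=> // x y xy; apply: (kAC (inl x) (inl y)).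
  exact/same_block_kernel.
by case: u => x; case: v => y /sA.
Qed.

Lemma double_idempotent {T : Type} (k : X -> T) :
  idempotents (pmonoid X) (double_partition k).
Proof.
apply: compat_inj => A D; rewrite compatM; split.
  by move=> /compat_double[<- sA]; exists A; apply/compat_double.
by move=> [C /compat_double[<- sA] /compat_double[<- _]]; apply/compat_double.
Qed.

Lemma graph_double_factorization (h : X + X -> X) (a : pmonoid X) :
  injective h ->
  exists2 e, idempotents (pmonoid X) e &
    a = graph_partition (h \o inl) * e * pflip (graph_partition (h \o inr)).
Proof.
(* [k (h u)] is the block of [u], and [k] is empty off the range of [h]; so the fibres of [k] inside
   this range are the images of the blocks of [a]. *)
move=> h_inj; pose k x := [set v | exists2 u, same_block a u v & x = h u].
have khE u w : k (h u) w <-> same_block a u w.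
  by split=> [[t tw /h_inj ->]|] //; exists u.
have khP u x : k (h u) = k x <-> exists2 v, same_block a u v & x = h v.
  split=> [E|[v uv ->]].
    have /khE := same_block_refl a u.
    by rewrite E => -[v /same_block_sym uv ->]; exists v.
  apply/seteqP; split=> w /khE uw; apply/khE; last exact: same_block_trans uw.
  exact: same_block_trans (same_block_sym uv) uw.
exists (double_partition k); first exact: double_idempotent.
(* The unqualified name denotes the gluing of functions of mathcomp-classical. *)
have image_h A D u : (h @` Defs.glue A D) (h u) <-> Defs.glue A D u.
  by split=> [[v Av /h_inj <-]|] //; exists u.
apply: compat_inj => A D; rewrite compatM; split=> [aAD|].
  (* The same set serves at both junctions; it is saturated because [glue A D] is a union of
     blocks. *)
  exists (h @` Defs.glue A D); last first.
    apply/compat_flip/compat_graph/seteqP.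
    by split=> x /(image_h A D (inr x)).
  apply/compatM; exists (h @` Defs.glue A D).
    by apply/compat_graph/seteqP; split=> x /(image_h A D (inl x)).
  apply/compat_double; split=> // x y kxy [u Au hu].
  move: kxy; rewrite -hu => /khP[v uv ->].
  by apply/image_h; apply: aAD Au.
move=> [C /compatM[_ /compat_graph -> /compat_double[-> sC]]].
move=> /compat_flip/compat_graph -> u v uv.
have glueC w : Defs.glue ((h \o inl) @^-1` C) ((h \o inr) @^-1` C) w = C (h w).
  by case: w.
by rewrite !glueC; apply: sC; apply/khP; exists v.
Qed.

End KernelPartitions.

(** * Both relative ranks *)

Theorem theorem30 (X : Type) (X_infinite : infinite_set [set: X]) :
  relative_rank_is (idempotents (pmonoid X)) `I_2 /\
  relative_rank_is (idempotents (pmonoid X) `|` pmonoid_units X) `I_2.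
Proof.
have [h h_inj] : exists h : X + X -> X, injective h.
  have [h h_inj] := infinite_bool_prod_inj X_infinite.
  exists (fun u => match u with inl x => h (x, true) | inr x => h (x, false) end).
  by move=> [x|x] [y|y] /h_inj // [->].
pose alpha := graph_partition (h \o inl).
pose beta := pflip (graph_partition (h \o inr)).
have unitsE : pmonoid_units X = @invertible (pmonoid X).
  by apply/funext => a; apply/propext; exact: pmonoid_unitsP.
have lower U : subsemigroup (idempotents (pmonoid X) `|` pmonoid_units X `|` U)
    = [set: pmonoid X] -> `I_2 #<= U.
  (* The point [h (inr x)] lies outside the range of [h \o inl], so [alpha] is right invertible but
     not a unit. *)
  have [x _] := infinite_setN0 X_infinite.
  rewrite unitsE; apply: (@relative_rank_ge2 _ alpha (pflip alpha)).
    by apply: graph_right_inverse => y z /h_inj [].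
  by apply: (@graph_not_left_inverse _ _ (h (inr x))) => y /h_inj.
(* This carries the upper bound from the idempotents to the larger set and the lower bound back. *)
have gen_mono (S T : set (pmonoid X)) :
    S `<=` T -> subsemigroup S = [set: pmonoid X] ->
    subsemigroup T = [set: pmonoid X].
  move=> ST genS; apply/seteqP; split=> // a _ V [Vmul TV].
  have : subsemigroup S a by rewrite genS.
  by apply; split=> // b /ST/TV.
have gen : subsemigroup (idempotents (pmonoid X) `|` [set alpha; beta])
    = [set: pmonoid X].
  apply/seteqP; split=> // a _ V [Vmul subV].
  have [e ee ->] := graph_double_factorization h a h_inj.
  apply: (Vmul); first apply: (Vmul).
  - by apply: subV; right; left.
  - by apply: subV; left.
  - by apply: subV; right; right.
have gen_units : subsemigroup
    (idempotents (pmonoid X) `|` pmonoid_units X `|` [set alpha; beta])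
    = [set: pmonoid X].
  by apply: gen_mono gen => a [ea|ga]; [left; left|right].
(* That [alpha] and [beta] differ follows from the lower bound itself, as they generate together
   with the idempotents and units. *)
have card_gens : [set alpha; beta] #= `I_2.
  rewrite card_eq_le lower // andbT.
  apply: card_le_trans (card_image_le (fun n => if n == 0%N then alpha else beta) _).
  by apply: subset_card_le => a [->|->]; [exists 0%N|exists 1%N].
split; split; try by exists [set alpha; beta].
  move=> U genU; apply: lower.
  by apply: gen_mono genU => a [ea|Ua]; [left; left|right].
exact: lower.
Qed.
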